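(* Let $\mathcal{D}$ be a set of quantum states with a neighbouring relation $\sim$, let $\mathcal{A}$ be a quantum algorithm, and let $\epsilon\ge0$, $\delta\ge0$. The following three statements are equivalent: (i) $\mathcal{A}$ is $(\epsilon,\delta)$-differentially private; (ii) $\sup_{\rho\sim\sigma}E_{e^\epsilon}(\mathcal{A}(\rho)\|\mathcal{A}(\sigma))\le\delta$; (iii) $\sup_{\rho\sim\sigma}D_{\max}^{\delta}(\mathcal{A}(\rho)\|\mathcal{A}(\sigma))\le\epsilon$. The suprema are over $\rho,\sigma\in\mathcal{D}$ with $\rho\sim\sigma$.
   Context: All Hilbert spaces are finite-dimensional. A quantum algorithm is a completely positive trace-preserving map. $\mathcal{A}$ is $(\epsilon,\delta)$-differentially private if for all operators $0\le M\le I$ (with $I$ the identity) and all $\rho,\sigma\in\mathcal{D}$ with $\rho\sim\sigma$ one has $\operatorname{Tr}(M\mathcal{A}(\rho))\le e^\epsilon\operatorname{Tr}(M\mathcal{A}(\sigma))+\delta$. The relation $\sim$ is an arbitrary fixed relation on $\mathcal{D}$ (a supremum over an empty set is read as making the inequality vacuously true). For a Hermitian operator $X$, $X^+$ is its positive part. For $\gamma\ge1$, $E_\gamma(\rho\|\sigma)=\operatorname{Tr}(\rho-\gamma\sigma)^+$ for positive semidefinite $\rho,\sigma$. The max-relative entropy is $D_{\max}(\rho\|\sigma)=\inf\{\lambda\in\mathbb{R}:\rho\le e^\lambda\sigma\}$ (with $\inf\emptyset=+\infty$), and the smooth version is $D_{\max}^{\delta}(\rho\|\sigma)=\inf_{\bar\rho\in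 B^\delta(\rho)}D_{\max}(\bar\rho\|\sigma)$ where $B^\delta(\rho)=\{\bar\rho:\bar\rho\ge0,\ E_1(\rho\|\bar\rho)\le\delta\}$; the operators $\bar\rho$ are positive semidefinite and need not be (sub)normalized. *)

(* Defs.v *)
From HB Require Import structures.
From mathcomp Require Import all_boot all_order all_algebra.
From mathcomp Require Import spectral sesquilinear.
From mathcomp Require Import all_classical all_reals all_analysis.
From mathcomp Require Import complex mxtens.

Set Implicit Arguments.
Unset Strict Implicit.
Unset Printing Implicit Defensive.

Import Order.TTheory GRing.Theory Num.Theory.

Local Open Scope classical_set_scope.
Local Open Scope sesquilinear_scope.
Local Open Scope complex_scope.
Local Open Scope ring_scope.

Section Operators.
Context {R : realType}.
Local Notation C := R[i].

(* The order on [R[i]] is the partial one: [0 <= z] means that [z] is real and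
   nonnegative. *)
Definition psd n (X : 'M[C]_n) : Prop :=
  X \is hermsymmx /\ forall v : 'cV[C]_n, 0 <= (v ^t* *m X *m v) 0 0.

Definition loewner_le n (X Y : 'M[C]_n) : Prop := psd (Y - X).

Definition quantum_state n (rho : 'M[C]_n) : Prop := psd rho /\ \tr rho = 1.

(* Meaningful for Hermitian [X] only: then [X = P^-1 * diag(d) * P] with [P]
   unitary and [d] real. *)
Definition pos_part n (X : 'M[C]_n) : 'M[C]_n :=
  invmx (spectralmx X)
    *m diag_mx (map_mx (fun x : C => Order.max 0 x) (spectral_diag X))
    *m spectralmx X.

(* The block of [X], acting on [C^k (x) C^n], at position [(i, j)] of the
   [C^k] factor. *)
Definition tens_block k n (X : 'M[C]_(k * n)) (i j : 'I_k) : 'M[C]_n :=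
  \matrix_(a, b) X (mxtens_index (i, a)) (mxtens_index (j, b)).

(* [id_k (x) A] *)
Definition ampliation k n m (A : 'M[C]_n -> 'M[C]_m) (X : 'M[C]_(k * n)) :
    'M[C]_(k * m) :=
  \sum_(i < k) \sum_(j < k) delta_mx i j *t A (tens_block X i j).

Definition completely_positive n m (A : 'M[C]_n -> 'M[C]_m) : Prop :=
  forall (k : nat) (X : 'M[C]_(k * n)), psd X -> psd (ampliation A X).

Definition trace_preserving n m (A : 'M[C]_n -> 'M[C]_m) : Prop :=
  forall X : 'M[C]_n, \tr (A X) = \tr X.

Definition quantum_algorithm n m (A : {linear 'M[C]_n -> 'M[C]_m}) : Prop :=
  completely_positive A /\ trace_preserving A.

(* The trace below is real; [complex.Re] only turns it into an element of
   [R]. *)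
Definition hockey_stick n (gamma : R) (rho sigma : 'M[C]_n) : R :=
  complex.Re (\tr (pos_part (rho - gamma%:C *: sigma))).

Definition Dmax n (rho sigma : 'M[C]_n) : \bar R :=
  ereal_inf
    [set lambda%:E | lambda in
      [set lambda : R | loewner_le rho ((expR lambda)%:C *: sigma)]].

Definition smoothing_ball n (delta : R) (rho : 'M[C]_n) : set 'M[C]_n :=
  [set rho' | psd rho' /\ hockey_stick 1 rho rho' <= delta].

Definition smooth_Dmax n (delta : R) (rho sigma : 'M[C]_n) : \bar R :=
  ereal_inf [set Dmax rho' sigma | rho' in smoothing_ball delta rho].

Definition neighbours n (D : set 'M[C]_n) (nbr : 'M[C]_n -> 'M[C]_n -> Prop) :
    set ('M[C]_n * 'M[C]_n) :=
  [set p | [/\ D p.1, D p.2 & nbr p.1 p.2]].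

Definition differentially_private n m (D : set 'M[C]_n)
    (nbr : 'M[C]_n -> 'M[C]_n -> Prop) (eps delta : R)
    (A : 'M[C]_n -> 'M[C]_m) : Prop :=
  forall M : 'M[C]_m, loewner_le 0 M -> loewner_le M 1%:M ->
  forall rho sigma : 'M[C]_n, D rho -> D sigma -> nbr rho sigma ->
    \tr (M *m A rho) <= (expR eps)%:C * \tr (M *m A sigma) + delta%:C.

End Operators.

(* Main.v *)
Require Import Defs.
From HB Require Import structures.
From mathcomp Require Import all_boot all_order all_algebra.
From mathcomp Require Import spectral sesquilinear.
From mathcomp Require Import all_classical all_reals all_analysis.
From mathcomp Require Import complex mxtens.

Set Implicit Arguments.
Unset Strict Implicit.
Unset Printing Implicit Defensive.

Import Order.TTheory GRing.Theory Num.Theory.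

Local Open Scope classical_set_scope.
Local Open Scope complex_scope.
Local Open Scope ring_scope.

(** For a Hermitian operator [X], the trace of its positive part is the maximum of
    [Tr (M X)] over the effects [0 <= M <= I].  With [X = rho - gamma sigma] this
    says that [E_gamma(rho || sigma) <= delta] iff every effect satisfies
    [Tr (M rho) <= gamma Tr (M sigma) + delta], which is differential privacy.
    If [D_max^delta(rho || sigma) <= eps] then for every [g > e^eps] some [rho']
    in the ball satisfies [rho' <= g sigma], so that
    [Tr (M rho) <= Tr (M rho') + delta <= g Tr (M sigma) + delta], and [g] tends
    to [e^eps].  Conversely [rho' = e^eps sigma] is an admissible smoothing of
    [rho], since the ball contains unnormalized operators and
    [E_1(rho || e^eps sigma)] is [E_{e^eps}(rho || sigma)]. *)

Section PositiveSemidefinite.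
Context {R : realType}.
Local Notation C := R[i].
Local Open Scope sesquilinear_scope.

(** * The cone of positive semidefinite matrices *)

Lemma hermsymmxP n (X : 'M[C]_n) : reflect (X = X ^t*) (X \is hermsymmx).
Proof. by apply: (iffP (is_hermitianmxP _ _ _)); rewrite expr0 scale1r. Qed.

Lemma adjmxM m n p (X : 'M[C]_(m, n)) (Y : 'M[C]_(n, p)) :
  (X *m Y) ^t* = Y ^t* *m X ^t*.
Proof. by rewrite trmx_mul map_mxM. Qed.

Lemma adjmxB m n (X Y : 'M[C]_(m, n)) : (X - Y) ^t* = X ^t* - Y ^t*.
Proof. by rewrite linearB /= map_mxB. Qed.

Lemma hermsymmxB n (X Y : 'M[C]_n) :
  X \is hermsymmx -> Y \is hermsymmx -> X - Y \is hermsymmx.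
Proof.
move=> /hermsymmxP hX /hermsymmxP hY.
by apply/hermsymmxP; rewrite adjmxB -hX -hY.
Qed.

Lemma psd_herm n (X : 'M[C]_n) : psd X -> X \is hermsymmx.
Proof. by case. Qed.

Lemma psd_congr n p (P : 'M[C]_(n, p)) (X : 'M[C]_n) :
  psd X -> psd (P ^t* *m X *m P).
Proof.
move=> [/hermsymmxP hX Xge0]; split.
  by apply/hermsymmxP; rewrite !adjmxM trmxCK -hX mulmxA.
by move=> v; have := Xge0 (P *m v); rewrite adjmxM !mulmxA.
Qed.

Lemma psd_diag_mx n (d : 'rV[C]_n) : (forall i, 0 <= d 0 i) -> psd (diag_mx d).
Proof.
move=> d_ge0; split.
  apply/hermsymmxP/matrixP => i j; rewrite !mxE rmorphMn /= eq_sym.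
  by case: eqP => [->|]; rewrite ?mulr0n// !mulr1n geC0_conj.
move=> v; rewrite mul_mx_diag mxE sumr_ge0 // => i _.
(* The quadratic form is the sum of the terms [|v_i|^2 * d_i]. *)
by rewrite !mxE mulrAC -normCKC mulr_ge0 ?exprn_ge0.
Qed.

Lemma psd_scale n (a : C) (X : 'M[C]_n) : 0 <= a -> psd X -> psd (a *: X).
Proof.
move=> a_ge0 [/hermsymmxP hX Xge0]; split.
  apply/hermsymmxP/matrixP => i j; rewrite {1}hX !mxE rmorphM /=.
  by rewrite (geC0_conj a_ge0).
by move=> v; rewrite -scalemxAr -scalemxAl mxE mulr_ge0.
Qed.

Lemma psd0 n : psd (0 : 'M[C]_n).
Proof.
by rewrite -(linear0 (@diag_mx C n)); apply: psd_diag_mx => i; rewrite mxE.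
Qed.

Lemma psdD n (X Y : 'M[C]_n) : psd X -> psd Y -> psd (X + Y).
Proof.
move=> [/hermsymmxP hX X_ge0] [/hermsymmxP hY Y_ge0]; split.
  by apply/hermsymmxP; rewrite linearD /= map_mxD -hX -hY.
by move=> v; rewrite mulmxDr mulmxDl mxE addr_ge0.
Qed.

Lemma psd_castmx n p (e : n = p) (X : 'M[C]_n) :
  psd (castmx (e, e) X) <-> psd X.
Proof. by case: _ / e; rewrite castmx_id. Qed.

Lemma psd_diag_ge0 n (X : 'M[C]_n) i : psd X -> 0 <= X i i.
Proof.
move=> [_ /(_ (delta_mx i 0))]; rewrite -mulmxA -colE.
have -> : (delta_mx i 0 : 'cV[C]_n) ^t* = delta_mx 0 i.
  by apply/matrixP => a b; rewrite !mxE rmorph_nat andbC.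
by rewrite -rowE !mxE.
Qed.

Lemma psd_trace_ge0 n (X : 'M[C]_n) : psd X -> 0 <= \tr X.
Proof. by move=> X_psd; rewrite sumr_ge0 // => i _; exact: psd_diag_ge0. Qed.

(** * Functional calculus of Hermitian matrices *)

Definition spectral_fun n (f : C -> C) (X : 'M[C]_n) : 'M[C]_n :=
  (spectralmx X) ^t* *m diag_mx (map_mx f (spectral_diag X)) *m spectralmx X.

Lemma spectralmxV n (X : 'M[C]_n) : spectralmx X *m (spectralmx X) ^t* = 1%:M.
Proof. exact/unitarymxP/spectral_unitarymx. Qed.

Lemma spectral_fun_id n (X : 'M[C]_n) : X \is hermsymmx ->
  spectral_fun id X = X.
Proof.
move=> hX; rewrite /spectral_fun [map_mx id _]map_mx_id //.
rewrite -invmx_unitary ?spectral_unitarymx //.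
exact/esym/orthomx_spectralP/hermitian_normalmx.
Qed.

Lemma spectral_fun1 n (X : 'M[C]_n) : spectral_fun (fun=> 1) X = 1%:M.
Proof.
rewrite /spectral_fun.
have -> : map_mx (fun=> 1) (spectral_diag X) = const_mx 1 :> 'rV[C]_n.
  by apply/rowP => i; rewrite !mxE.
by rewrite diag_const_mx mulmx1; apply: mulmx1C; apply: spectralmxV.
Qed.

Lemma spectral_funB n (f g : C -> C) (X : 'M[C]_n) :
  spectral_fun f X - spectral_fun g X = spectral_fun (fun x => f x - g x) X.
Proof.
rewrite /spectral_fun; set d := spectral_diag X.
have -> : map_mx (fun x => f x - g x) d = map_mx f d - map_mx g d.
  by apply/rowP => i; rewrite !mxE.
by rewrite linearB /= mulmxBr mulmxBl.
Qed.

Lemma spectral_funM n (f g : C -> C) (X : 'M[C]_n) :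
  spectral_fun f X *m spectral_fun g X = spectral_fun (fun x => f x * g x) X.
Proof.
rewrite /spectral_fun; set P := spectralmx X; set d := spectral_diag X.
have -> : diag_mx (map_mx (fun x => f x * g x) d) =
    diag_mx (map_mx f d) *m diag_mx (map_mx g d).
  by rewrite mulmx_diag; congr diag_mx; apply/rowP => i; rewrite !mxE.
by rewrite -!mulmxA (mulmxA P) spectralmxV mul1mx.
Qed.

Lemma eq_spectral_fun n (f g : C -> C) (X : 'M[C]_n) : X \is hermsymmx ->
  {in Num.real, f =1 g} -> spectral_fun f X = spectral_fun g X.
Proof.
move=> /hermitian_spectral_diag_real/mxOverP d_real fg; rewrite /spectral_fun.
suff -> : map_mx f (spectral_diag X) = map_mx g (spectral_diag X) by [].
by apply/rowP => i; rewrite !mxE fg.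
Qed.

(** With an adjoint where [pos_part] has an inverse, [spectral_fun] is a congruence of a diagonal
    matrix, whose entries are values of [f] at real eigenvalues. *)
Lemma psd_spectral_fun n (f : C -> C) (X : 'M[C]_n) : X \is hermsymmx ->
  {in Num.real, forall x, 0 <= f x} -> psd (spectral_fun f X).
Proof.
move=> /hermitian_spectral_diag_real/mxOverP d_real f_ge0.
by apply/psd_congr/psd_diag_mx => i; rewrite mxE f_ge0.
Qed.

(** For [P = spectralmx X], the eigenvalue is a diagonal entry of the congruent matrix [P X P^*]. *)
Lemma psd_spectral_diag_ge0 n (X : 'M[C]_n) i :
  psd X -> 0 <= spectral_diag X 0 i.
Proof.
move=> X_psd; have := psd_diag_ge0 i (psd_congr ((spectralmx X) ^t*) X_psd).
rewrite trmxCK -{2}(spectral_fun_id (psd_herm X_psd)) /spectral_fun !mulmxA.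
rewrite spectralmxV mul1mx -mulmxA spectralmxV mulmx1 [map_mx id _]map_mx_id // mxE.
by rewrite eqxx mulr1n.
Qed.

Lemma psd_mxtrace_mul_ge0 n (X Y : 'M[C]_n) :
  psd X -> psd Y -> 0 <= \tr (X *m Y).
Proof.
move=> X_psd Y_psd; rewrite -(spectral_fun_id (psd_herm X_psd)) /spectral_fun.
rewrite [map_mx id _]map_mx_id // -!mulmxA mxtrace_mulC -!mulmxA mul_diag_mx.
have := psd_congr ((spectralmx X) ^t*) Y_psd; rewrite trmxCK -mulmxA => Z_psd.
rewrite sumr_ge0 // => i _; rewrite mxE mulr_ge0 //.
  exact: psd_spectral_diag_ge0.
exact: psd_diag_ge0.
Qed.

(** * From complete positivity to positivity, by the ampliation with [k = 1] *)

Lemma ampliation1 n m (A : 'M[C]_n -> 'M[C]_m) (X : 'M[C]_n) :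
  ampliation A (castmx (esym (mul1n n), esym (mul1n n)) X) =
  castmx (esym (mul1n m), esym (mul1n m)) (A X).
Proof.
rewrite /ampliation !big_ord1.
have -> : delta_mx 0 0 = 1%:M :> 'M[C]_1.
  by apply/matrixP => i j; rewrite !ord1 !mxE.
rewrite tens_scalar1mx; congr (castmx _ (A _)).
apply/matrixP => a b; rewrite mxE castmxE.
by congr (X _ _); apply: val_inj.
Qed.

Lemma completely_positive_psd n m (A : 'M[C]_n -> 'M[C]_m) (X : 'M[C]_n) :
  completely_positive A -> psd X -> psd (A X).
Proof.
move=> A_cp X_psd; apply/(psd_castmx (esym (mul1n m))).
by rewrite -ampliation1; apply: A_cp; apply/psd_castmx.
Qed.

(** * Positive parts and effects *)

Lemma pos_partE n (X : 'M[C]_n) : pos_part X = spectral_fun (Order.max 0) X.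
Proof. by rewrite /pos_part invmx_unitary ?spectral_unitarymx. Qed.

Lemma psd_pos_part n (X : 'M[C]_n) : X \is hermsymmx -> psd (pos_part X).
Proof.
move=> hX; rewrite pos_partE; apply: psd_spectral_fun => // x _.
(* [Order.max 0 x] is [x] if [0 < x] and [0] otherwise, so it is nonnegative although the order on
   [C] is partial. *)
by rewrite /Order.max; case: ifP => // /ltW.
Qed.

Lemma loewner_le_pos_part n (X : 'M[C]_n) :
  X \is hermsymmx -> loewner_le X (pos_part X).
Proof.
move=> hX; rewrite /loewner_le -{2}(spectral_fun_id hX) pos_partE spectral_funB.
apply: psd_spectral_fun => // x x_real; rewrite subr_ge0 /Order.max.
(* Realness of the eigenvalue matters here: for a non-real [x] the maximum is [0], and [0 - x] is
   not nonnegative. *)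
by case: (real_ltP (real0 _) x_real).
Qed.

(** Two steps: [Tr (M X) <= Tr (M X^+)] because [X <= X^+] and [0 <= M], then [Tr (M X^+) <= Tr X^+]
    because [M <= I] and [0 <= X^+]. *)
Lemma mxtrace_effect_le n (M X : 'M[C]_n) : X \is hermsymmx ->
  loewner_le 0 M -> loewner_le M 1%:M -> \tr (M *m X) <= \tr (pos_part X).
Proof.
rewrite /loewner_le subr0 => hX M_ge0 M_le1.
have := psd_mxtrace_mul_ge0 M_ge0 (loewner_le_pos_part hX).
rewrite mulmxBr linearB /= subr_ge0 => /le_trans; apply.
have := psd_mxtrace_mul_ge0 M_le1 (psd_pos_part hX).
by rewrite mulmxBl mul1mx linearB /= subr_ge0.
Qed.

Lemma mxtrace_effect_attained n (X : 'M[C]_n) : X \is hermsymmx ->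
  exists2 M, loewner_le 0 M /\ loewner_le M 1%:M &
    \tr (M *m X) = \tr (pos_part X).
Proof.
(* The witness is the spectral projector onto the positive eigenvalues. *)
move=> hX; exists (spectral_fun (fun x => (0 < x)%R%:R) X); last first.
  rewrite -{2}(spectral_fun_id hX) spectral_funM pos_partE.
  congr (\tr _); apply: eq_spectral_fun => // x _.
  by rewrite /Order.max; case: ifP; rewrite ?mul1r ?mul0r.
rewrite /loewner_le subr0 -(spectral_fun1 X) spectral_funB.
split; apply: psd_spectral_fun => // x _.
by rewrite subr_ge0; case: (0 < x)%R; rewrite ?ler01.
Qed.

(** * Hockey-stick divergence and smooth max-relative entropy *)

Lemma hockey_stickE n (gamma : R) (rho sigma : 'M[C]_n) :
  rho - gamma%:C *: sigma \is hermsymmx ->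
  (hockey_stick gamma rho sigma)%:C = \tr (pos_part (rho - gamma%:C *: sigma)).
Proof.
by move=> hX; apply/RRe_real/ger0_real/psd_trace_ge0/psd_pos_part.
Qed.

(** Serves twice: with [gamma = expR eps] for privacy, and with [gamma = 1] for membership in the
    smoothing ball. *)
Lemma hockey_stick_leP n (gamma delta : R) (rho sigma : 'M[C]_n) :
  0 <= gamma -> psd rho -> psd sigma ->
  hockey_stick gamma rho sigma <= delta <->
  forall M, loewner_le 0 M -> loewner_le M 1%:M ->
    \tr (M *m rho) <= gamma%:C * \tr (M *m sigma) + delta%:C.
Proof.
move=> gamma_ge0 rho_psd sigma_psd.
have hX : rho - gamma%:C *: sigma \is hermsymmx.
  apply: hermsymmxB; first exact: psd_herm.
  by apply/psd_herm/psd_scale => //; rewrite lecR.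
have trE M : \tr (M *m (rho - gamma%:C *: sigma)) =
    \tr (M *m rho) - gamma%:C * \tr (M *m sigma).
  by rewrite mulmxBr linearB /= -scalemxAr linearZ.
rewrite -lecR hockey_stickE //; split=> [hs_le M M_ge0 M_le1|test_le].
  by rewrite -lerBlDl -trE (le_trans _ hs_le) // mxtrace_effect_le.
have [M [M_ge0 M_le1] <-] := mxtrace_effect_attained hX.
by rewrite trE lerBlDl test_le.
Qed.

(** The strict gap between [expR eps] and [g] makes up for infima that may not be attained: [ln g]
    exceeds both nested infima, so each has a member below it. *)
Lemma smooth_Dmax_le_loewner n (eps delta g : R) (rho sigma : 'M[C]_n) :
  psd sigma -> (smooth_Dmax delta rho sigma <= eps%:E)%E -> expR eps < g ->
  exists2 rho', smoothing_ball delta rho rho' &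
    loewner_le rho' (g%:C *: sigma).
Proof.
move=> sigma_psd sD_le eps_g.
have g_gt0 : 0 < g := lt_trans (expR_gt0 eps) eps_g.
have : (smooth_Dmax delta rho sigma < (ln g)%:E)%E.
  by rewrite (le_lt_trans sD_le) // lte_fin -ltr_expR lnK.
move=> /ereal_inf_lt[_ [rho' rho'_ball <-]] /ereal_inf_lt[_ [l rho'_le <-]].
rewrite lte_fin -ltr_expR lnK ?posrE // => /ltW l_g.
exists rho'; first exact: rho'_ball.
rewrite /loewner_le.
(* This splits [rho' <= g sigma] into [rho' <= e^l sigma] and [e^l sigma <= g sigma]. *)
have -> : g%:C *: sigma - rho' = (g - expR l)%:C *: sigma +
    ((expR l)%:C *: sigma - rho').
  by rewrite addrA -scalerDl -rmorphD /= subrK.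
apply: psdD; last exact: rho'_le.
by apply: psd_scale; [rewrite lecR subr_ge0|].
Qed.

Lemma hockey_stick_smooth_Dmax n (eps delta : R) (rho sigma : 'M[C]_n) :
  psd rho -> psd sigma ->
  hockey_stick (expR eps) rho sigma <= delta <->
  (smooth_Dmax delta rho sigma <= eps%:E)%E.
Proof.
move=> rho_psd sigma_psd; have g_ge0 := expR_ge0 eps; split=> [hs_le|sD_le].
  apply: le_trans (_ : Dmax ((expR eps)%:C *: sigma) sigma <= _)%E.
    apply: ereal_inf_lbound; exists ((expR eps)%:C *: sigma); last by [].
    split.
      by apply: psd_scale; rewrite ?lecR.
    by rewrite /hockey_stick scale1r.
  apply: ereal_inf_lbound; exists eps; last by [].
  by rewrite /= /loewner_le subrr; apply: psd0.
apply/hockey_stick_leP => // M M_ge0 M_le1.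
have M_psd : psd M by move: M_ge0; rewrite /loewner_le subr0.
(* The traces are real, so the inequality descends to [R], where it suffices to prove it up to every
   [e > 0]. *)
have tr_real tau : psd tau ->
    exists2 t : R, 0 <= t & \tr (M *m tau) = t%:C.
  move=> /(psd_mxtrace_mul_ge0 M_psd) t_ge0.
  exists (complex.Re (\tr (M *m tau))); last by rewrite RRe_real ?ger0_real.
  by rewrite -lecR RRe_real ?ger0_real.
have [a _ aE] := tr_real _ rho_psd; have [t t_ge0 tE] := tr_real _ sigma_psd.
rewrite aE tE -rmorphM -rmorphD lecR; apply/ler_addgt0Pr => e e_gt0.
(* Enlarging [expR eps] by [e / (t + 1)] costs [e * t / (t + 1) <= e]; the [+ 1] covers the case
   [t = 0]. *)
have t1_gt0 : 0 < t + 1 by rewrite ltr_wpDl.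
have [|rho' [rho'_psd hs_le] rho'_le] :=
    @smooth_Dmax_le_loewner _ _ _ (expR eps + e / (t + 1)) _ _ sigma_psd sD_le.
  by rewrite ltrDl divr_gt0.
have /(_ M M_ge0 M_le1) := (hockey_stick_leP delta ler01 rho_psd rho'_psd).1 hs_le.
have := psd_mxtrace_mul_ge0 M_psd rho'_le.
rewrite mulmxBr linearB /= -scalemxAr linearZ /= subr_ge0 tE aE mul1r.
rewrite -(lerD2r delta%:C) => /[swap] /le_trans/[apply].
rewrite -rmorphM -rmorphD lecR => /le_trans; apply.
rewrite mulrDl addrAC lerD2l mulrAC ler_pdivrMr // ler_wpM2l ?ltW //.
by rewrite ltrDl.
Qed.

End PositiveSemidefinite.

Theorem mainTheorem3 (R : realType) (n m : nat)
    (D : set 'M[R[i]]_n) (D_states : forall rho, D rho -> quantum_state rho)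
    (nbr : 'M[R[i]]_n -> 'M[R[i]]_n -> Prop)
    (A : {linear 'M[R[i]]_n -> 'M[R[i]]_m}) (A_alg : quantum_algorithm A)
    (eps delta : R) (eps_ge0 : 0 <= eps) (delta_ge0 : 0 <= delta) :
  (differentially_private D nbr eps delta A <->
   (ereal_sup [set (hockey_stick (expR eps) (A p.1) (A p.2))%:E
               | p in neighbours D nbr] <= delta%:E)%E)
  /\
  ((ereal_sup [set (hockey_stick (expR eps) (A p.1) (A p.2))%:E
               | p in neighbours D nbr] <= delta%:E)%E <->
   (ereal_sup [set smooth_Dmax delta (A p.1) (A p.2)
               | p in neighbours D nbr] <= eps%:E)%E).
Proof.
have A_psd rho : D rho -> psd (A rho).
  by case: A_alg => A_cp _ /D_states[rho_psd _]; exact: completely_positive_psd.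
have g_ge0 := expR_ge0 eps.
(* Reduces each supremum to single pairs; with no neighbouring pairs the supremum is [-oo] and both
   sides hold. *)
have sup_leP f (c : R) : (ereal_sup [set f p | p in neighbours D nbr] <= c%:E)%E
    <-> forall p, neighbours D nbr p -> (f p <= c%:E)%E.
  split=> [sup_le p Dp|f_le].
    by apply: le_trans sup_le; apply: ereal_sup_ubound; exists p.
  by apply: ge_ereal_sup => _ [p Dp <-]; exact: f_le.
split; split.
- move=> dp; apply/sup_leP => -[rho sigma] [/= Drho Dsigma rs]; rewrite lee_fin.
  by apply/hockey_stick_leP; [|exact: A_psd..|] => // M M0 M1; exact: dp.
- move=> /sup_leP hs_le M M0 M1 rho sigma Drho Dsigma rs.
  have := hs_le (rho, sigma) (And3 Drho Dsigma rs); rewrite lee_fin /=.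
  by move=> /(hockey_stick_leP _ g_ge0 (A_psd _ Drho) (A_psd _ Dsigma)); exact.
- move=> /sup_leP hs_le; apply/sup_leP => p Dp; have := hs_le p Dp.
  case: Dp => Dp1 Dp2 _; rewrite lee_fin.
  by move=> /hockey_stick_smooth_Dmax; apply; exact: A_psd.
- move=> /sup_leP sD_le; apply/sup_leP => p Dp; have := sD_le p Dp.
  case: Dp => Dp1 Dp2 _; rewrite lee_fin.
  by move=> /hockey_stick_smooth_Dmax; apply; exact: A_psd.
Qed.
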